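(* Let $\mu>0$ and let $X$ be a non-negative real random variable with mean $\mathrm{E}[X]=\mu$ such that $\mathrm{E}[\exp(tX)]\le \exp(\mu(e^t-1))$ for all $t>0$. Then for all real $k>0$, $$\mathrm{E}\left[(X/\mu)^k\right]\le\left(\frac{k/\mu}{\log(1+k/\mu)}\right)^k\le\left(1+\frac{k}{2\mu}\right)^k\le\exp\left(\frac{k^2}{2\mu}\right).$$
   Context: $\log$ denotes the natural logarithm. *)

(* Defs.v *)
From mathcomp Require Import all_boot.

(* Main.v *)
Require Import Defs.
From mathcomp Require Import all_boot all_order all_algebra.
From mathcomp Require Import all_classical all_reals all_analysis.
From mathcomp Require Import measurable_realfun ring lra.
Set Implicit Arguments.
Unset Strict Implicit.
Unset Printing Implicit Defensive.
Import Order.TTheory GRing.Theory Num.Theory.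
Import numFieldNormedType.Exports.
Local Open Scope classical_set_scope.
Local Open Scope ring_scope.

(** The moment bound is a Chernoff argument. Since [u <= e^(u - 1)], taking
    [u = t x / k] and raising to the power [k] bounds [(x / mu)^k] by
    [(k / (mu t))^k e^(t x - k)] for every [t > 0]
    ([powR_le_expR], integrated in [powR_moment_le_mgf]). The hypothesis on the
    moment generating function then gives
    [E[(X / mu)^k] <= (k / (mu t))^k e^(mu (e^t - 1) - k)], and the choice
    [t = ln (1 + k / mu)] makes the exponential equal to [1], since then
    [mu (e^t - 1) = k].

    The two remaining inequalities are monotonicity of [y |-> y `^ k] applied to
    [y / ln (1 + y) <= 1 + y / 2 <= e^(y / 2)] at [y = k / mu]. The first of
    these, under [y = e^t - 1], is the trapezoidal estimate
    [2 (e^t - 1) <= t (e^t + 1)] for the convex function [exp] on [[0, t]]. *)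

(** The constant is the maximum of [(x / m)^k e^(- t x)], attained at [x = k / t], so
    for fixed [t] it cannot be improved. *)
Lemma powR_le_expR (R : realType) (m t k x : R) :
  0 < m -> 0 < t -> 0 < k -> 0 <= x ->
  (x / m) `^ k <= (k / m / t) `^ k * expR (- k) * expR (t * x).
Proof.
move=> m0 t0 k0 x0.
have km0 : 0 <= k / m / t by rewrite !divr_ge0 // ltW.
have u0 : 0 <= t * x / k by rewrite divr_ge0 ?mulr_ge0 // ltW.
have -> : x / m = k / m / t * (t * x / k) by field; rewrite !gt_eqF.
rewrite powRM // -[leRHS]mulrA ler_wpM2l ?powR_ge0 // -expRD.
have -> : - k + t * x = (t * x / k - 1) * k by field; rewrite gt_eqF.
rewrite expRM ge0_ler_powR ?nnegrE ?expR_ge0 ?(ltW k0) //.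
by have := expR_ge1Dx (t * x / k - 1); rewrite addrC subrK.
Qed.

Lemma powR_moment_le_mgf (R : realType) (d : measure_display)
    (T : measurableType d) (P : probability T R) (X : {RV P >-> R})
    (m t k : R) :
  0 < m -> 0 < t -> 0 < k -> {ae P, forall w, 0 <= X w} ->
  ('E_P[fun w => ((X w / m) `^ k)%R]
    <= ((k / m / t) `^ k * expR (- k))%R%:E * 'E_P[fun w => expR (t * X w)%R])%E.
Proof.
move=> m0 t0 k0 X0.
have mexp : measurable_fun setT (fun w => expR (t * X w)).
  by apply: measurableT_comp => //; exact: measurable_funM.
rewrite unlock -ge0_integralZl_EFin //; last 2 first.
- exact/measurable_EFinP.
- by rewrite mulr_ge0 ?powR_ge0 ?expR_ge0.
apply: ae_ge0_le_integral => //.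
- by move=> w _; rewrite lee_fin powR_ge0.
- apply/measurable_EFinP.
  apply: (measurableT_comp (measurable_powR _)) => //.
  exact: measurable_funM.
- by move=> w _; rewrite -EFinM lee_fin !mulr_ge0 ?powR_ge0 ?expR_ge0.
- apply/measurable_EFinP; exact: measurable_funM.
- apply: filterS X0 => w Xw _.
  by rewrite -EFinM lee_fin powR_le_expR.
Qed.

(** The function [t (e^t + 1) - 2 (e^t - 1)] vanishes at [0], and its derivative
    [1 + (t - 1) e^t] is nonnegative because [1 - t <= e^(- t)]. *)
Lemma expR_sub1_le_trapezoid (R : realType) (t : R) :
  0 <= t -> 2 * (expR t - 1) <= t * (expR t + 1).
Proof.
move=> t0; rewrite -subr_ge0.
pose f := fun s : R => s * (expR s + 1) - 2 * (expR s - 1).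
have df (s : R) : is_derive s (1 : R) f (1 + (s - 1) * expR s).
  rewrite /f; apply: is_derive_eq; rewrite /GRing.scale /=.
  by ring.
have [|c _] := MVT_segment t0 (fun s _ => df s).
  apply: derivable_within_continuous => s _.
  by have [] := df s.
rewrite /f expR0 mul0r subrr mulr0 !subr0 => ->.
rewrite mulr_ge0 //.
have := ler_wpM2r (expR_ge0 c) (expR_ge1Dx (- c)).
by rewrite -expRD addNr expR0 => ?; lra.
Qed.

(** Dividing by [ln (1 + y)] turns this into the trapezoidal estimate at
    [t = ln (1 + y)]. *)
Lemma div_ln1D_le (R : realType) (y : R) :
  0 < y -> y / ln (1 + y) <= 1 + y / 2.
Proof.
move=> y0.
have l0 : 0 < ln (1 + y) by rewrite ln_gt0 // ltrDl.
rewrite ler_pdivrMr //.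
have := expR_sub1_le_trapezoid (ltW l0).
by rewrite lnK ?posrE ?addr_gt0 // => ?; lra.
Qed.

Theorem corollary1 (R : realType) (d : measure_display) (T : measurableType d)
    (P : probability T R) (X : {RV P >-> R}) (mu : R) (hmu : 0 < mu)
    (hX0 : {ae P, forall w, 0 <= X w})
    (hmean : ('E_P[X] = mu%:E)%E)
    (hmgf : forall t : R, 0 < t ->
      ('E_P[fun w => expR (t * X w)%R] <= (expR (mu * (expR t - 1)))%:E)%E)
    (k : R) (hk : 0 < k) :
  [/\ ('E_P[fun w => ((X w / mu) `^ k)%R]
         <= (((k / mu) / ln (1 + k / mu)) `^ k)%:E)%E,
      ((k / mu) / ln (1 + k / mu)) `^ k <= (1 + k / (2 * mu)) `^ k
    & (1 + k / (2 * mu)) `^ k <= expR (k ^+ 2 / (2 * mu))].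
Proof.
have y0 : 0 < k / mu by rewrite divr_gt0.
have l0 : 0 < ln (1 + k / mu) by rewrite ln_gt0 // ltrDl.
have half : k / (2 * mu) = k / mu / 2 by field; rewrite gt_eqF.
have b0 : 0 <= 1 + k / (2 * mu) by rewrite half addr_ge0 ?divr_ge0 // ltW.
split.
- apply: le_trans (powR_moment_le_mgf hmu l0 hk hX0) _.
  set C := (_ `^ k).
  have C0 : 0 <= C * expR (- k) by rewrite mulr_ge0 ?powR_ge0 ?expR_ge0.
  (* With t = ln (1 + k / mu) the exponent of the mgf bound is exactly k, which
     cancels the factor expR (- k). *)
  apply: le_trans (lee_wpmul2l _ (hmgf _ l0)) _; rewrite ?lee_fin //.
  have -> : mu * (expR (ln (1 + k / mu)) - 1) = k.
    by rewrite lnK ?posrE ?addr_gt0 //; field; rewrite gt_eqF.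
  by rewrite -mulrA -expRD addNr expR0 mulr1.
- rewrite ge0_ler_powR ?nnegrE ?(ltW (divr_gt0 y0 l0)) ?(ltW hk) //.
  by rewrite half div_ln1D_le.
- have -> : k ^+ 2 / (2 * mu) = k / (2 * mu) * k by field; rewrite gt_eqF.
  by rewrite expRM ge0_ler_powR ?nnegrE ?expR_ge0 ?expR_ge1Dx // ltW.
Qed.
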